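(* Let $I$ be an operator assigning to every bi-cooperative game $v$ on every finite player set $N$ a family of reals $(I^v_{S,T})_{(S,T)\in\mathcal{Q}(N)}$, and suppose that for every such $v$ and all distinct $i,j\in N$ (with $n=|N|$, lower-case letters denoting cardinalities): \[ I^v_{i,\emptyset}=\sum_{S\subseteq N\setminus\{i\}}\tfrac{(n-s-1)!s!}{n!}\Delta_{i,\emptyset}v(S,N\setminus(S\cup\{i\})),\quad I^v_{\emptyset,i}=\sum_{S\subseteq N\setminus\{i\}}\tfrac{(n-s-1)!s!}{n!}\Delta_{\emptyset,i}v(S,N\setminus S), \] \[ I^v_{i,j}=\sum_{S\subseteq N\setminus\{i,j\}}\tfrac{(n-s-2)!s!}{(n-1)!}\Delta_{i,j}v(S,N\setminus(S\cup\{i\})). \] Then $I$ satisfies the recursivity property (R) below if and only if, for every bi-cooperative game $v$ on any finite $N$ and every $(S,T)\in\mathcal{Q}(N)$ with $(S,T)\neq(\emptyset,\emptyset)$, \[ I^v_{S,T}=\sum_{K\subseteq N\setminus(S\cup T)}\frac{(n-s-t-k)!\,k!}{(n-s-t+1)!}\,\Delta_{S,T}v(K,N\setminus(K\cup S)). \] Property (R): for every bi-cooperative game $v$ on a finite set $N$, \[ I^v_{S,T}=I^{v_{[S]}}_{[S],T}-\sum_{\emptyset\neq K\subsetneq S}I^{v^{N\setminus K}_0}_{S\setminus K,T}\quad\forall (S,T)\in\mathcal{Q}(N),\ S\neq\emptyset, \] \[ I^v_{S,T}=I^{v_{[T]}}_{S,[T]}-\sum_{\emptyset\neq K\subsetneq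 T}I^{v^{N\setminus K}_-}_{S,T\setminus K}\quad\forall (S,T)\in\mathcal{Q}(N),\ T\neq\emptyset. \]
   Context: For a finite set $N$, $\mathcal{Q}(N)=\{(A,B)\in 2^N\times 2^N : A\cap B=\emptyset\}$. A bi-cooperative game on $N$ is any $v:\mathcal{Q}(N)\to\mathbb{R}$ with $v(\emptyset,\emptyset)=0$. Singletons are written without braces in subscripts ($I^v_{i,j}=I^v_{\{i\},\{j\}}$, etc.). For $(S,T)\in\mathcal{Q}(N)$ and $(K,L)\in\mathcal{Q}(N\setminus S)$ with $L\supseteq T$, the derivative is $\Delta_{S,T}v(K,L)=\sum_{S'\subseteq S,\,T'\subseteq T}(-1)^{(s-s')+(t-t')}v(K\cup S',L\setminus T')$. For $\emptyset\neq K\subseteq N$: the reduced game $v_{[K]}$ is the bi-cooperative game on $N_{[K]}=(N\setminus K)\cup\{[K]\}$ (all players of $K$ merged into one new player $[K]$) given by $v_{[K]}(S,T)=v(\eta_{[K]}(S),\eta_{[K]}(T))$, where $\eta_{[K]}(S)=S$ if $[K]\notin S$ and $\eta_{[K]}(S)=(S\setminus\{[K]\})\cup K$ otherwise; the restricted games on $N\setminus K$ are $v^{N\setminus K}_0(S,T)=v(S,T)$ and $v^{N\setminus K}_-(S,T)=v(S,T\cup K)$ for $(S,T)\in\mathcal{Q}(N\setminus K)$.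
   Formalization: In (R) the restricted game v_-^{N∖K} is taken as v(S,T∪K) − v(∅,K) instead of v(S,T∪K), since the latter need not vanish at (∅,∅) and is then not a bi-cooperative game, so that I would be undefined on it. *)

(* Defs.v *)
From mathcomp Require Import all_boot all_order all_algebra.
From mathcomp Require Import reals.

Set Implicit Arguments.
Unset Strict Implicit.
Unset Printing Implicit Defensive.

Import Order.TTheory GRing.Theory Num.Theory.
Local Open Scope ring_scope.

(* Player sets are finite types.  If K is a set of players of N, the player   *)
(* set N \ K is the subtype [rest K], and the player set of the reduced game, *)
(* in which K is merged into one new player, is [option (rest K)], where      *)
(* [None] is the merged player and [Some x] an unaffected one.                *)

Notation Qset N := {p : {set N} * {set N} | p.1 :&: p.2 == set0}.

Definition rest (N : finType) (K : {set N}) : finType := {x | x \notin K}.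

(* The default value 0 is returned only if A and B intersect; every pair at   *)
(* which [ev] is used below is disjoint.                                      *)
Definition ev (R : realType) (N : finType) (f : {ffun Qset N -> R})
    (A B : {set N}) : R :=
  if insub (A, B) is Some q then f q else 0.

Record bigame (R : realType) (N : finType) := Game {
  game_fun :> {ffun Qset N -> R};
  game_fun0 : ev game_fun set0 set0 == 0 }.

Definition bideriv (R : realType) (N : finType) (S T : {set N}) (v : bigame R N)
    (K L : {set N}) : R :=
  \sum_(S' : {set N} | S' \subset S) \sum_(T' : {set N} | T' \subset T)
    (-1) ^+ ((#|S| - #|S'|) + (#|T| - #|T'|)) * ev v (K :|: S') (L :\: T').

Lemma evE (R : realType) (N : finType) (F : Qset N -> R) (A B : {set N})
    (AB : A :&: B == set0) :
  ev [ffun q => F q] A B =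
    F (exist (fun p : {set N} * {set N} => p.1 :&: p.2 == set0) (A, B) AB).
Proof.
by rewrite /ev (@insubT _ (fun p => p.1 :&: p.2 == set0) _ (_, _) AB) ffunE.
Qed.

Section Normalize.
Variables (R : realType) (N : finType).

Lemma normalize_subproof (f : {ffun Qset N -> R}) :
  ev [ffun q => f q - ev f set0 set0] set0 set0 == 0.
Proof.
have h : (set0 : {set N}) :&: set0 == set0 by rewrite setI0.
rewrite (evE _ h) /ev (@insubT _ (fun p => p.1 :&: p.2 == set0) _ (_, _) h).
by rewrite subrr.
Qed.

Definition normalize (f : {ffun Qset N -> R}) : bigame R N :=
  Game (normalize_subproof f).

End Normalize.

Section DerivedGames.
Variables (R : realType) (N : finType) (v : bigame R N) (K : {set N}).

Definition from_rest (A : {set rest K}) : {set N} := [set sval x | x in A].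

Definition merge_eta (A : {set option (rest K)}) : {set N} :=
  [set sval x | x : rest K & Some x \in A]
    :|: (if None \in A then K else set0).

Definition reduced_fun : {ffun Qset (option (rest K)) -> R} :=
  [ffun q : Qset (option (rest K)) =>
     ev v (merge_eta (sval q).1) (merge_eta (sval q).2)].

Lemma reduced_subproof : ev reduced_fun set0 set0 == 0.
Proof.
have h : (set0 : {set option (rest K)}) :&: set0 == set0 by rewrite setI0.
rewrite (evE _ h) /=.
have -> : merge_eta set0 = set0.
  rewrite /merge_eta inE setU0; apply/setP=> y; rewrite inE.
  by apply/negP => /imsetP [x]; rewrite !inE.
exact: game_fun0.
Qed.

Definition reduced : bigame R (option (rest K)) := Game reduced_subproof.

Definition restrict0_fun : {ffun Qset (rest K) -> R} :=
  [ffun q : Qset (rest K) =>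
     ev v (from_rest (sval q).1) (from_rest (sval q).2)].

Lemma restrict0_subproof : ev restrict0_fun set0 set0 == 0.
Proof.
have h : (set0 : {set rest K}) :&: set0 == set0 by rewrite setI0.
rewrite (evE _ h) /= /from_rest imset0; exact: game_fun0.
Qed.

Definition restrict0 : bigame R (rest K) := Game restrict0_subproof.

Definition restrictN_fun : {ffun Qset (rest K) -> R} :=
  [ffun q : Qset (rest K) =>
     ev v (from_rest (sval q).1) (from_rest (sval q).2 :|: K)].

(* [restrictN_fun] takes the value v(set0, K) at (set0, set0), so subtracting *)
(* this constant is needed to obtain a bi-cooperative game; derivatives of    *)
(* order at least one are not affected.                                       *)
Definition restrictN : bigame R (rest K) := normalize restrictN_fun.

End DerivedGames.

(* A set of players of N as a set of players of [rest K] (its members in K    *)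
(* are dropped), and as a set of players of the reduced game not containing   *)
(* the merged player.                                                         *)
Definition to_rest (N : finType) (K A : {set N}) : {set rest K} :=
  [set x | sval x \in A].

Definition to_reduced (N : finType) (K A : {set N}) : {set option (rest K)} :=
  [set Some x | x in to_rest K A].

Definition bi_operator (R : realType) :=
  forall N : finType, bigame R N -> {ffun Qset N -> R}.

Definition recursivity (R : realType) (I : bi_operator R) : Prop :=
  forall (N : finType) (v : bigame R N) (S T : {set N}), S :&: T = set0 ->
  (S != set0 ->
     ev (I N v) S T =
       ev (I _ (reduced v S)) [set None] (to_reduced S T)
       - \sum_(K : {set N} | (K != set0) && (K \proper S))
           ev (I _ (restrict0 v K)) (to_rest K (S :\: K)) (to_rest K T))
  /\
  (T != set0 ->
     ev (I N v) S T =
       ev (I _ (reduced v T)) (to_reduced T S) [set None]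
       - \sum_(K : {set N} | (K != set0) && (K \proper T))
           ev (I _ (restrictN v K)) (to_rest K S) (to_rest K (T :\: K))).

(* Main.v *)
(* Write D_S g for the sum of (-1)^(s-s') g(S') over S' in S, so that the
   derivative is D_S D_T of (S', T') |-> v(K u S', L \ T').  Moebius inversion,
   sum_{K in S} D_K g = g(S), gives for nonempty S
     D_S g = (g(S) - g({})) - sum_{{} <> K < S} D_{S \ K} g,
   where g(S) - g({}) is the derivative of the reduced game in the direction of
   the merged player and D_{S \ K} that of a restricted game.  The sets
   N \ (S u T) attached to all the games involved are the same, and the weights
   depend only on their cardinality, so the recursion holds term by term and
   the formula satisfies (R).  Conversely (R) expresses I_{S,T} through indices
   with smaller s + t until s, t <= 1, so it has at most one solution with the
   given initial values. *)

Require Import Defs.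
From mathcomp Require Import all_boot all_order all_algebra.
From mathcomp Require Import reals.

Set Implicit Arguments.
Unset Strict Implicit.
Unset Printing Implicit Defensive.

Import Order.TTheory GRing.Theory Num.Theory.
Local Open Scope ring_scope.

(** * Alternating sums over subsets and Moebius inversion *)

Section AlternatingSums.
Variables (R : realType) (N : finType).
Implicit Types (S T K X : {set N}) (g : {set N} -> R).

(** The operator [D_S g]. The truncated subtraction in the exponent is exact, since only subsets of
    [S] are summed. *)
Definition altsum S g : R :=
  \sum_(S' : {set N} | S' \subset S) (-1) ^+ (#|S| - #|S'|) * g S'.

Lemma eq_altsum S g1 g2 :
  (forall X, X \subset S -> g1 X = g2 X) -> altsum S g1 = altsum S g2.
Proof. by move=> eq_g; apply: eq_bigr => X XS; rewrite eq_g. Qed.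

Lemma altsum0 g : altsum set0 g = g set0.
Proof.
rewrite /altsum (big_pred1 set0) => [|X]; last by rewrite subset0.
by rewrite cards0 mul1r.
Qed.

Lemma altsum1 x g : altsum [set x] g = g [set x] - g set0.
Proof.
rewrite /altsum (bigD1 [set x]) //= (big_pred1 set0) => [|X].
  by rewrite cards1 cards0 subnn subn0 mul1r mulN1r.
rewrite subset1; case: eqP => [->|_] /=; last by rewrite andbT.
by rewrite -cards_eq0 cards1.
Qed.

Lemma altsumB S g1 g2 :
  altsum S (fun X => g1 X - g2 X) = altsum S g1 - altsum S g2.
Proof. by rewrite /altsum -sumrB; apply: eq_bigr => X _; rewrite mulrBr. Qed.

Lemma altsum_sum (J : Type) (r : seq J) (P : pred J) S (G : J -> {set N} -> R) :
  altsum S (fun X => \sum_(j <- r | P j) G j X)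
    = \sum_(j <- r | P j) altsum S (G j).
Proof.
by rewrite exchange_big; apply: eq_bigr => X _; rewrite mulr_sumr.
Qed.

Lemma sign_cardB S X : X \subset S ->
  (-1) ^+ (#|S| - #|X|) = (-1) ^+ #|S :\: X| :> R.
Proof. by move=> XS; rewrite cardsD (setIidPr XS). Qed.

(** The product over all players of [-1 + 1] on [S] and [0 + 1] off [S] expands into this sum, and
    its factor at any player of [S] vanishes. *)
Lemma sum_sign_subset S : S != set0 ->
  \sum_(X : {set N} | X \subset S) (-1) ^+ #|X| = 0 :> R.
Proof.
case/set0Pn=> x xS.
transitivity (\prod_i ((if i \in S then -1 else 0) + 1) : R); last first.
  by rewrite (bigD1 x) //= xS addNr mul0r.
rewrite bigA_distr big_mkcond /=; apply: eq_bigr => X _.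
rewrite -big_mkcond /=; case: ifP => [/subsetP XS|/negbT].
  by rewrite (eq_bigr (fun=> -1)) ?prodr_const // => i /XS ->.
by case/subsetPn=> y yX /negPf yS; rewrite (bigD1 y) //= yS mul0r.
Qed.

(** Complementation in [S] turns the signs into [(-1) ^+ #|X|], which sum to zero. This is what
    later removes the normalizing constant of [restrictN]. *)
Lemma altsum_const S c : S != set0 -> altsum S (fun=> c) = 0.
Proof.
move=> S0; rewrite /altsum -mulr_suml [X in X * _](_ : _ = 0) ?mul0r //.
rewrite (reindex_onto (fun X => S :\: X) (fun X => S :\: X)) /=; last first.
  by move=> X XS; rewrite setDDr setDv set0U (setIidPr XS).
rewrite -[RHS](sum_sign_subset S0); apply: eq_big => [X|X /andP[_ /eqP eX]].
  rewrite subsetDl /= setDDr setDv set0U.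
  by apply/eqP/setIidPr.
by rewrite sign_cardB ?subsetDl // eX.
Qed.

(** Moebius inversion on the subset lattice. After exchanging the sums, the coefficient of [g X] is
    a signed count of the sets between [X] and [S], which vanishes unless [X = S]. *)
Lemma sum_altsum S g :
  \sum_(K : {set N} | K \subset S) altsum K g = g S.
Proof.
rewrite (exchange_big_dep (fun X => X \subset S)) /=; last first.
  by move=> K X KS XK; apply: subset_trans KS.
rewrite (bigD1 S) //= [X in _ + X]big1 => [|X /andP[XS neXS]].
  rewrite addr0 (big_pred1 S) => [|K]; last by rewrite /= -eqEsubset.
  by rewrite subnn mul1r.
rewrite -mulr_suml [Y in Y * _](_ : _ = 0) ?mul0r //.
have SX0 : S :\: X != set0.
  by rewrite setD_eq0; apply: contra neXS => SX; rewrite eqEsubset XS.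
rewrite -[RHS](sum_sign_subset SX0).
(* The sets between [X] and [S] are the [X :|: B] with [B] a subset of [S :\: X]. *)
rewrite (reindex_onto (fun B => X :|: B) (fun K => K :\: X)) /=; last first.
  by move=> K /andP[_ /setIidPr XK]; rewrite -[X in X :|: _]XK setID.
apply: eq_big => [B|B /andP[/andP[_ XB] /eqP eB]]; last first.
  by rewrite sign_cardB // eB.
rewrite subUset XS subsetUl andbT /= setDUl setDv set0U subsetD.
by congr andb; apply/eqP/setDidPl.
Qed.

(** Moebius inversion at [S] with the terms for [S] and [set0] split off; complementation in [S]
    permutes the remaining nonempty proper subsets. *)
Lemma altsum_rec S g : S != set0 ->
  altsum S g = g S - g set0
    - \sum_(K : {set N} | (K != set0) && (K \proper S)) altsum (S :\: K) g.
Proof.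
move=> S0; rewrite -[g S]sum_altsum (bigD1 S) //= (bigD1 set0) /=; last first.
  by rewrite sub0set eq_sym.
rewrite altsum0 -addrA -opprD.
suff -> : \sum_(K : {set N} | (K != set0) && (K \proper S)) altsum (S :\: K) g
    = \sum_(K : {set N} | (K \subset S) && (K != S) && (K != set0)) altsum K g.
  by rewrite addrK.
apply/esym.
rewrite (reindex_onto (fun K => S :\: K) (fun K => S :\: K)) /=; last first.
  by move=> K /andP[/andP[KS _] _]; rewrite setDDr setDv set0U (setIidPr KS).
apply: eq_bigl => K; rewrite subsetDl setDDr setDv set0U properE setD_eq0 /=.
have -> : (S :&: K == K) = (K \subset S) by apply/eqP/setIidPr.
case KS: (K \subset S); rewrite ?andbF // andbT; congr (~~ _ && ~~ _).
apply/eqP/eqP => [/setDidPl|->]; last by rewrite setD0.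
by rewrite -setI_eq0 (setIidPr KS) => /eqP.
Qed.

End AlternatingSums.

(** * Transport of coalitions to restricted and reduced player sets *)

Lemma subset_imply (N : finType) (A B : {set N}) :
  A \subset B -> forall x, (x \in A) ==> (x \in B).
Proof. by move=> /subsetP AB x; apply/implyP/AB. Qed.

(** Decides pointwise set identities by a truth table on the membership tests in the goal.
    Inclusions must first be moved into the goal as boolean implications, which is the purpose of
    [subset_imply]. *)
Ltac set_cases :=
  rewrite ?inE /=; repeat match goal with
  | |- context [in_mem ?x ?A] => case: (in_mem x A) => //=
  end.

(** Direct image along an injection is a bijection between the two families of subsets, with
    preimage as its inverse. *)
Lemma sum_subset_imset (V : nmodType) (N N' : finType) (f : N -> N')
    (F : {set N'} -> V) (B : {set N}) : injective f ->
  \sum_(A' : {set N'} | A' \subset f @: B) F A'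
    = \sum_(A : {set N} | A \subset B) F (f @: A).
Proof.
move=> f_inj; rewrite (reindex_onto (fun A : {set N} => f @: A)
  (fun A' : {set N'} => f @^-1: A')) /=.
  apply: eq_bigl => A.
  have -> : f @^-1: (f @: A) = A by apply/setP=> x; rewrite inE mem_imset.
  rewrite eqxx andbT; apply/subsetP/subsetP => AB x xA.
    by have := AB _ (imset_f f xA); rewrite mem_imset.
  by case/imsetP: xA => y yA ->; apply/imset_f/AB.
move=> A' /subsetP A'B; apply/setP=> y.
apply/imsetP/idP => [[x]|yA']; first by rewrite inE => + ->.
by have /imsetP[x _ ey] := A'B _ yA'; exists x => //; rewrite inE -ey.
Qed.

Section PlayerSets.
Variable N : finType.
Implicit Types (A B K : {set N}).

Lemma from_rest_to_rest K A : from_rest (to_rest K A) = A :\: K.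
Proof.
apply/setP=> x; rewrite !inE; apply/imsetP/andP => [[y]|[xK xA]].
  by rewrite inE => yA ->; split=> //; apply: (svalP y).
by exists (exist _ x xK) => //; rewrite inE.
Qed.

Lemma to_rest_from_rest K (A : {set rest K}) : to_rest K (from_rest A) = A.
Proof.
by apply/setP=> x; rewrite inE mem_imset //; apply: val_inj.
Qed.

Lemma to_restU K A B : to_rest K (A :|: B) = to_rest K A :|: to_rest K B.
Proof. by apply/setP=> x; rewrite !inE. Qed.

Lemma to_restD K A B : to_rest K (A :\: B) = to_rest K A :\: to_rest K B.
Proof. by apply/setP=> x; rewrite !inE. Qed.

Lemma to_restC K A : to_rest K (~: A) = ~: to_rest K A.
Proof. by apply/setP=> x; rewrite !inE. Qed.

Lemma setD_disjoint K A : A \subset ~: K -> A :\: K = A.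
Proof. by rewrite -disjoints_subset => /setDidPl. Qed.

Lemma sum_subset_to_rest (V : nmodType) K B (F : {set rest K} -> V) :
  B \subset ~: K ->
  \sum_(A' : {set rest K} | A' \subset to_rest K B) F A'
    = \sum_(A : {set N} | A \subset B) F (to_rest K A).
Proof.
move=> BK; have {2}-> : B = [set sval x | x in to_rest K B].
  by rewrite -[LHS](setD_disjoint BK) -from_rest_to_rest.
rewrite sum_subset_imset; last exact: val_inj.
by apply: eq_bigr => A _; rewrite -[in LHS](to_rest_from_rest A).
Qed.

Lemma card_to_rest K A : A \subset ~: K -> #|to_rest K A| = #|A|.
Proof.
move=> AK; rewrite -[in RHS](setD_disjoint AK) -from_rest_to_rest.
by rewrite card_imset //; apply: val_inj.
Qed.

Lemma mem_to_reduced K A (x : rest K) :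
  (Some x \in to_reduced K A) = (sval x \in A).
Proof. by rewrite mem_imset ?inE // => ? ? []. Qed.

Lemma None_to_reduced K A : (None \in to_reduced K A) = false.
Proof. by apply/negbTE/imsetP => -[]. Qed.

Lemma to_reducedU K A B :
  to_reduced K (A :|: B) = to_reduced K A :|: to_reduced K B.
Proof. by rewrite /to_reduced to_restU imsetU. Qed.

Lemma to_reducedD K A B :
  to_reduced K (A :\: B) = to_reduced K A :\: to_reduced K B.
Proof.
by apply/setP=> -[x|]; rewrite !inE ?mem_to_reduced ?None_to_reduced ?inE.
Qed.

Lemma setC_to_reduced K A : ~: to_reduced K A = None |: to_reduced K (~: A).
Proof.
by apply/setP=> -[x|]; rewrite !inE ?mem_to_reduced ?None_to_reduced ?inE.
Qed.

Lemma setC_None_to_reduced K A :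
  ~: (None |: to_reduced K A) = to_reduced K (~: A).
Proof.
by apply/setP=> -[x|]; rewrite !inE ?mem_to_reduced ?None_to_reduced ?inE.
Qed.

Lemma sum_subset_to_reduced (V : nmodType) K B
    (F : {set option (rest K)} -> V) :
  B \subset ~: K ->
  \sum_(A' : {set option (rest K)} | A' \subset to_reduced K B) F A'
    = \sum_(A : {set N} | A \subset B) F (to_reduced K A).
Proof.
move=> BK; rewrite sum_subset_imset; last by move=> ? ? [].
exact: (sum_subset_to_rest (fun A : {set rest K} => F [set Some x | x in A])).
Qed.

Lemma card_to_reduced K A : A \subset ~: K -> #|to_reduced K A| = #|A|.
Proof. by move=> AK; rewrite card_imset ?card_to_rest // => ? ? []. Qed.

Lemma merge_etaE K (A : {set option (rest K)}) :
  merge_eta A =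
    from_rest [set x | Some x \in A] :|: (if None \in A then K else set0).
Proof.
congr (_ :|: _); apply/setP=> y; apply/imsetP/imsetP => -[x xA ->];
  by exists x; rewrite ?inE // in xA *.
Qed.

Lemma merge_eta_to_reduced K A : merge_eta (to_reduced K A) = A :\: K.
Proof.
rewrite merge_etaE None_to_reduced setU0 -from_rest_to_rest; congr from_rest.
by apply/setP => x; rewrite !inE mem_to_reduced.
Qed.

Lemma merge_eta_None_to_reduced K A :
  merge_eta (None |: to_reduced K A) = A :|: K.
Proof.
rewrite merge_etaE setU11 -[RHS](_ : A :\: K :|: K = _).
  rewrite -from_rest_to_rest; congr (from_rest _ :|: _).
  by apply/setP => x; rewrite !inE mem_to_reduced.
by apply/setP=> x; set_cases.
Qed.

Lemma to_rest_disjoint K A B :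
  A :&: B = set0 -> to_rest K A :&: to_rest K B = set0.
Proof.
by move=> AB; apply/setP=> x; have /setP/(_ (sval x)) := AB; rewrite !inE.
Qed.

Lemma to_reduced_disjoint K A B :
  A :&: B = set0 -> to_reduced K A :&: to_reduced K B = set0.
Proof.
move=> AB; apply/setP=> -[x|]; rewrite !inE ?mem_to_reduced ?None_to_reduced //.
by have /setP/(_ (sval x)) := AB; rewrite !inE.
Qed.

Lemma None_to_reduced_disjoint K A : [set None] :&: to_reduced K A = set0.
Proof. by apply/setP=> -[x|]; rewrite !inE ?None_to_reduced. Qed.

(** A player of [A] outside [K] survives the restriction. This keeps the restricted indices away
    from the pair of empty sets, about which the formula says nothing. *)
Lemma to_restD_neq0 K A : K \proper A -> to_rest K (A :\: K) != set0.
Proof.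
case/properP=> _ [x xA xK]; apply/set0Pn; exists (exist _ x xK).
by rewrite !inE xA andbT.
Qed.

Lemma card_to_restD K A : K != set0 -> K \subset A ->
  (#|to_rest K (A :\: K)| < #|A|)%N.
Proof.
move=> K0 KA; rewrite card_to_rest; last by rewrite setDE subsetIr.
rewrite cardsDS // ltn_subrL card_gt0 K0 (leq_trans _ (subset_leq_card KA)) //.
by rewrite card_gt0.
Qed.

End PlayerSets.

(** * Values of the derived games on transported coalitions *)

Section Evaluation.
Variables (R : realType) (N : finType) (v : bigame R N).
Implicit Types (A B K : {set N}).

(** Disjointness keeps the left-hand side off the default value of [ev]. *)
Lemma ev_reduced K (A B : {set option (rest K)}) : A :&: B = set0 ->
  ev (reduced v K) A B = ev v (merge_eta A) (merge_eta B).
Proof. by move=> /eqP AB; rewrite (evE _ AB). Qed.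

Lemma ev_reduced0 K A B : A :&: B = set0 ->
  ev (reduced v K) (to_reduced K A) (to_reduced K B) = ev v (A :\: K) (B :\: K).
Proof.
by move=> AB; rewrite ev_reduced ?to_reduced_disjoint // !merge_eta_to_reduced.
Qed.

Lemma ev_reducedl K A B : A :&: B = set0 ->
  ev (reduced v K) (None |: to_reduced K A) (to_reduced K B)
    = ev v (A :|: K) (B :\: K).
Proof.
move=> AB.
rewrite ev_reduced ?merge_eta_to_reduced ?merge_eta_None_to_reduced //.
rewrite setIUl to_reduced_disjoint // setU0; apply/setP=> -[x|].
  by rewrite !inE.
by rewrite !inE None_to_reduced.
Qed.

Lemma ev_reducedr K A B : A :&: B = set0 ->
  ev (reduced v K) (to_reduced K A) (None |: to_reduced K B)
    = ev v (A :\: K) (B :|: K).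
Proof.
move=> AB.
rewrite ev_reduced ?merge_eta_to_reduced ?merge_eta_None_to_reduced //.
rewrite setIUr to_reduced_disjoint // setU0; apply/setP=> -[x|].
  by rewrite !inE andbF.
by rewrite !inE None_to_reduced.
Qed.

Lemma ev_restrict0 K A B : A :&: B = set0 ->
  ev (restrict0 v K) (to_rest K A) (to_rest K B) = ev v (A :\: K) (B :\: K).
Proof.
move=> AB; have /eqP dAB := to_rest_disjoint K AB.
by rewrite (evE _ dAB) /= !from_rest_to_rest.
Qed.

Lemma ev_restrictN K A B : A :&: B = set0 ->
  ev (restrictN v K) (to_rest K A) (to_rest K B)
    = ev v (A :\: K) (B :|: K) - ev v set0 K.
Proof.
move=> AB; have /eqP dAB := to_rest_disjoint K AB.
have d0 : (set0 : {set rest K}) :&: set0 == set0 by rewrite setI0.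
rewrite /restrictN /normalize /= (evE _ dAB) (evE _ d0) ffunE /=.
rewrite !from_rest_to_rest /from_rest imset0 set0U; congr (ev v _ _ - _).
by apply/setP=> x; set_cases.
Qed.

End Evaluation.

(** * The closed formula, with derivatives as iterated alternating sums *)

Section Index.
Variable R : realType.

(** For [k <= m] this is the Beta integral of [x^k (1-x)^(m-k)] over the unit interval. *)
Definition beta_weight m k : R := ((m - k)`! * k`!)%:R / ((m + 1)`!)%:R.

(** The claimed formula, with [n - s - t] expressed as the size of the complement of [S :|: T]. In
    this form the weights are visibly the same for the reduced and restricted games. *)
Definition biindex (N : finType) (v : bigame R N) (S T : {set N}) : R :=
  \sum_(A : {set N} | A \subset ~: (S :|: T))
    beta_weight #|~: (S :|: T)| #|A| * bideriv S T v A (~: (A :|: S)).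

Lemma bideriv_altsum (N : finType) (v : bigame R N) (S T K L : {set N}) :
  bideriv S T v K L =
    altsum S (fun S' => altsum T (fun T' => ev v (K :|: S') (L :\: T'))).
Proof.
apply: eq_bigr => S' _; rewrite mulr_sumr; apply: eq_bigr => T' _.
by rewrite exprD mulrA.
Qed.

Lemma altsum_to_rest (N : finType) (K B : {set N}) (g : {set rest K} -> R) :
  B \subset ~: K ->
  altsum (to_rest K B) g = altsum B (fun X => g (to_rest K X)).
Proof.
move=> BK; rewrite /altsum sum_subset_to_rest //; apply: eq_bigr => X XB.
by rewrite !card_to_rest // (subset_trans XB).
Qed.

Lemma altsum_to_reduced (N : finType) (K B : {set N})
    (g : {set option (rest K)} -> R) :
  B \subset ~: K ->
  altsum (to_reduced K B) g = altsum B (fun X => g (to_reduced K X)).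
Proof.
move=> BK; rewrite /altsum sum_subset_to_reduced //; apply: eq_bigr => X XB.
by rewrite !card_to_reduced // (subset_trans XB).
Qed.

(** Allows either direction of the derivative to be made the innermost one, where the one-variable
    identities apply. *)
Lemma altsum_exchange (N : finType) (S T : {set N})
    (G : {set N} -> {set N} -> R) :
  altsum S (fun X => altsum T (G X)) = altsum T (fun Y => altsum S (G^~ Y)).
Proof.
rewrite /altsum; under eq_bigr do rewrite mulr_sumr.
under [RHS]eq_bigr do rewrite mulr_sumr.
by rewrite exchange_big; do 2!apply: eq_bigr => ? _; rewrite mulrCA.
Qed.

End Index.

(** * The closed formula satisfies both recursions *)

Section Recursion.
Variables (R : realType) (N : finType) (v : bigame R N) (S T : {set N}).
Hypothesis ST : S :&: T = set0.

Let weight (A : {set N}) : R := beta_weight R #|~: (S :|: T)| #|A|.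
(** The common integrand: the next five lemmas express every index of the recursion through [vST],
    over the same sets [A] and with the same weights. *)
Let vST (A S' T' : {set N}) : R := ev v (A :|: S') (~: (A :|: S) :\: T').

Let inST x : (x \in S) && (x \in T) = false.
Proof. by have /setP/(_ x) := ST; rewrite !inE. Qed.

Lemma biindex_altsum : biindex v S T =
  \sum_(A : {set N} | A \subset ~: (S :|: T))
    weight A * altsum S (fun S' => altsum T (vST A S')).
Proof. by apply: eq_bigr => A _; rewrite bideriv_altsum. Qed.

(** The direction [[set None]] is a singleton, so its alternating sum is a difference: the merged
    player joins the first coalition, adding all of [S], or joins neither. *)
Lemma biindex_reducedl :
  biindex (reduced v S) [set None] (to_reduced S T) =
  \sum_(A : {set N} | A \subset ~: (S :|: T))
    weight A * altsum T (fun T' => vST A S T' - vST A set0 T').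
Proof.
have TS : T \subset ~: S by rewrite -disjoints_subset -setI_eq0 setIC ST.
have MS : ~: (S :|: T) \subset ~: S by rewrite setCS subsetUl.
rewrite /biindex setC_None_to_reduced.
(* Players of [S] have no counterpart in [rest S], so both complements transport to the same set. *)
have -> : to_reduced S (~: T) = to_reduced S (~: (S :|: T)).
  apply/setP=> -[x|]; rewrite ?None_to_reduced // !mem_to_reduced !inE.
  by rewrite (negPf (svalP x)).
rewrite sum_subset_to_reduced // card_to_reduced //.
apply: eq_bigr => A AM; have AS := subset_trans AM MS.
(* The exchange puts the singleton direction innermost, ready for [altsum1]. *)
rewrite card_to_reduced // bideriv_altsum altsum_exchange altsum_to_reduced //.
congr (_ * _); apply: eq_altsum => T' T'T; rewrite altsum1.
rewrite setUC setC_None_to_reduced -to_reducedD setU0.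
rewrite ev_reducedl ?ev_reduced0; try by apply/setP=> x; set_cases.
by congr (ev v _ _ - ev v _ _); apply/setP=> x;
  move: (subset_imply AS x); set_cases.
Qed.

(** Here the merged player starts in the second coalition; deleting it deletes all of [T], and
    keeping it keeps all of [T]. *)
Lemma biindex_reducedr :
  biindex (reduced v T) (to_reduced T S) [set None] =
  \sum_(A : {set N} | A \subset ~: (S :|: T))
    weight A * altsum S (fun S' => vST A S' T - vST A S' set0).
Proof.
have SdT : S \subset ~: T by rewrite -disjoints_subset -setI_eq0 ST.
have MT : ~: (S :|: T) \subset ~: T by rewrite setCS subsetUr.
rewrite /biindex setUC setC_None_to_reduced.
have -> : to_reduced T (~: S) = to_reduced T (~: (S :|: T)).
  apply/setP=> -[x|]; rewrite ?None_to_reduced // !mem_to_reduced !inE.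
  by rewrite (negPf (svalP x)) orbF.
rewrite sum_subset_to_reduced // card_to_reduced //.
apply: eq_bigr => A AM; have AT := subset_trans AM MT.
rewrite card_to_reduced // bideriv_altsum altsum_to_reduced //.
congr (_ * _); apply: eq_altsum => S' S'S; rewrite altsum1.
rewrite -!to_reducedU setC_to_reduced setD0.
have -> : (None |: to_reduced T (~: (A :|: S))) :\ None
    = to_reduced T (~: (A :|: S)).
  by apply/setP=> -[x|]; rewrite !inE ?None_to_reduced //= mem_to_reduced.
have dA : (A :|: S') :&: ~: (A :|: S) = set0.
  by apply/setP=> x; move: (subset_imply S'S x); set_cases.
rewrite ev_reducedr ?ev_reduced0 //.
by congr (ev v _ _ - ev v _ _); apply/setP=> x;
  move: (subset_imply AT x) (inST x) (subset_imply S'S x); set_cases.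
Qed.

(** For [S'] inside [S :\: K], the players of [K] lie neither in [A :|: S'] nor in the complement of
    [A :|: S], exactly as [restrict0] prescribes. *)
Lemma biindex_restrict0 (K : {set N}) : K \subset S ->
  biindex (restrict0 v K) (to_rest K (S :\: K)) (to_rest K T) =
  \sum_(A : {set N} | A \subset ~: (S :|: T))
    weight A * altsum (S :\: K) (fun S' => altsum T (vST A S')).
Proof.
move=> KS; have KS' := subset_imply KS.
have MK : ~: (S :|: T) \subset ~: K by rewrite setCS subsetU // KS.
have TK : T \subset ~: K.
  by apply/subsetP=> x; move: (KS' x) (inST x); set_cases.
have SK : S :\: K \subset ~: K by apply/subsetP=> x; set_cases.
rewrite /biindex -to_restU -to_restC.
have -> : to_rest K (~: (S :\: K :|: T)) = to_rest K (~: (S :|: T)).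
  by apply/setP=> x; rewrite !inE (svalP x).
rewrite sum_subset_to_rest // card_to_rest //.
apply: eq_bigr => A AM; have AK := subset_trans AM MK.
rewrite card_to_rest // bideriv_altsum altsum_to_rest //.
congr (_ * _); apply: eq_altsum => S' S'S; rewrite altsum_to_rest //.
apply: eq_altsum => T' T'T; rewrite -!to_restU -to_restC -to_restD.
have S'S' := subset_imply S'S.
rewrite ev_restrict0; last by apply/setP=> x; move: (S'S' x); set_cases.
by congr (ev v _ _); apply/setP=> x;
  move: (S'S' x) (KS' x) (subset_imply AK x); set_cases.
Qed.

(** For [T'] inside [T :\: K], the players of [K] all remain in the second coalition, as in
    [restrictN]. Properness makes [T :\: K] nonempty, so the normalizing constant cancels. *)
Lemma biindex_restrictN (K : {set N}) : K \proper T ->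
  biindex (restrictN v K) (to_rest K S) (to_rest K (T :\: K)) =
  \sum_(A : {set N} | A \subset ~: (S :|: T))
    weight A * altsum S (fun S' => altsum (T :\: K) (vST A S')).
Proof.
rewrite properE => /andP[KT TK]; have KT' := subset_imply KT.
have TK0 : T :\: K != set0 by rewrite setD_eq0.
have MK : ~: (S :|: T) \subset ~: K by rewrite setCS subsetU // KT orbT.
have SK : S \subset ~: K.
  by apply/subsetP=> x; move: (KT' x) (inST x); set_cases.
have TKK : T :\: K \subset ~: K by apply/subsetP=> x; set_cases.
rewrite /biindex -to_restU -to_restC.
have -> : to_rest K (~: (S :|: (T :\: K))) = to_rest K (~: (S :|: T)).
  by apply/setP=> x; rewrite !inE (svalP x).
rewrite sum_subset_to_rest // card_to_rest //.
apply: eq_bigr => A AM; have AK := subset_trans AM MK.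
rewrite card_to_rest // bideriv_altsum altsum_to_rest //.
congr (_ * _); apply: eq_altsum => S' S'S; rewrite altsum_to_rest //.
(* The zero is rewritten as the alternating sum of the normalizing constant, to match the value of
   [restrictN]. *)
rewrite -[RHS]subr0 -(altsum_const (ev v set0 K) TK0) -altsumB.
apply: eq_altsum => T' T'T; rewrite -!to_restU -to_restC -to_restD.
have S'S' := subset_imply S'S.
rewrite ev_restrictN; last by apply/setP=> x; move: (S'S' x); set_cases.
by congr (ev v _ _ - _); apply/setP=> x;
  move: (S'S' x) (KT' x) (subset_imply AK x) (inST x) (subset_imply T'T x);
  set_cases.
Qed.

Lemma biindex_recl : S != set0 ->
  biindex v S T = biindex (reduced v S) [set None] (to_reduced S T)
    - \sum_(K : {set N} | (K != set0) && (K \proper S))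
        biindex (restrict0 v K) (to_rest K (S :\: K)) (to_rest K T).
Proof.
move=> S0; rewrite biindex_altsum biindex_reducedl.
under [X in _ - X]eq_bigr => K /andP[_ /proper_sub KS] do
  rewrite biindex_restrict0 //.
rewrite [X in _ - X]exchange_big -sumrB; apply: eq_bigr => A _ /=.
(* For a fixed [A], the sum over [S] is brought inside the sum over [T], so that [altsum_rec]
   applies for each [T']. *)
rewrite -mulr_sumr -mulrBr altsum_exchange.
under [X in _ * (_ - X)]eq_bigr do rewrite altsum_exchange.
rewrite -altsum_sum -altsumB; congr (_ * _); apply: eq_altsum => T' _.
exact: altsum_rec.
Qed.

Lemma biindex_recr : T != set0 ->
  biindex v S T = biindex (reduced v T) (to_reduced T S) [set None]
    - \sum_(K : {set N} | (K != set0) && (K \proper T))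
        biindex (restrictN v K) (to_rest K S) (to_rest K (T :\: K)).
Proof.
move=> T0; rewrite biindex_altsum biindex_reducedr.
under [X in _ - X]eq_bigr => K /andP[_ KT] do rewrite biindex_restrictN //.
rewrite [X in _ - X]exchange_big -sumrB; apply: eq_bigr => A _ /=.
rewrite -mulr_sumr -mulrBr -altsum_sum -altsumB; congr (_ * _).
by apply: eq_altsum => S' _; apply: altsum_rec.
Qed.

(** Since [S] and [T] are disjoint, their union has size [s + t]. *)
Lemma biindexE : biindex v S T =
  \sum_(K : {set N} | K \subset ~: (S :|: T))
    ((#|N| - #|S| - #|T| - #|K|)`! * #|K|`!)%:R
      / ((#|N| - #|S| - #|T| + 1)`!)%:R
    * bideriv S T v K (~: (K :|: S)).
Proof.
have -> : (#|N| - #|S| - #|T|)%N = #|~: (S :|: T)|; last by [].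
by rewrite [RHS]cardsCs setCK cardsU ST cards0 subn0 subnDA.
Qed.

End Recursion.

(** * Agreement with the initial values, and uniqueness by induction on the order *)

Theorem theorem4 (R : realType) (I : bi_operator R)
  (I_i0 : forall (N : finType) (v : bigame R N) (i : N),
    ev (I N v) [set i] set0 =
      \sum_(S : {set N} | S \subset ~: [set i])
        ((#|N| - #|S| - 1)`! * #|S|`!)%:R / (#|N|`!)%:R
        * bideriv [set i] set0 v S (~: (S :|: [set i])))
  (I_0i : forall (N : finType) (v : bigame R N) (i : N),
    ev (I N v) set0 [set i] =
      \sum_(S : {set N} | S \subset ~: [set i])
        ((#|N| - #|S| - 1)`! * #|S|`!)%:R / (#|N|`!)%:R
        * bideriv set0 [set i] v S (~: S))
  (I_ij : forall (N : finType) (v : bigame R N) (i j : N), i != j ->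
    ev (I N v) [set i] [set j] =
      \sum_(S : {set N} | S \subset ~: [set i; j])
        ((#|N| - #|S| - 2)`! * #|S|`!)%:R / ((#|N| - 1)`!)%:R
        * bideriv [set i] [set j] v S (~: (S :|: [set i]))) :
  recursivity I <->
  (forall (N : finType) (v : bigame R N) (S T : {set N}),
     S :&: T = set0 -> (S, T) != (set0, set0) ->
     ev (I N v) S T =
       \sum_(K : {set N} | K \subset ~: (S :|: T))
         ((#|N| - #|S| - #|T| - #|K|)`! * #|K|`!)%:R
           / ((#|N| - #|S| - #|T| + 1)`!)%:R
         * bideriv S T v K (~: (K :|: S))).
Proof.
have base_l (N : finType) (v : bigame R N) i :
    ev (I N v) [set i] set0 = biindex v [set i] set0.
  rewrite I_i0 biindexE ?setI0 // setU0; apply: eq_bigr => A _.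
  (* Subtraction is truncated, so [n - 1 + 1 = n] in the denominator requires a player. *)
  have nN : (0 < #|N|)%N by apply/card_gt0P; exists i.
  by rewrite cards1 cards0 subn0 subnK // subnAC.
have base_r (N : finType) (v : bigame R N) i :
    ev (I N v) set0 [set i] = biindex v set0 [set i].
  rewrite I_0i biindexE ?set0I // set0U; apply: eq_bigr => A _.
  have nN : (0 < #|N|)%N by apply/card_gt0P; exists i.
  by rewrite cards1 cards0 subn0 subnK // subnAC setU0.
have base_lr (N : finType) (v : bigame R N) i j : i != j ->
    ev (I N v) [set i] [set j] = biindex v [set i] [set j].
  move=> ij; rewrite I_ij // biindexE; last first.
    by apply/setP=> x; rewrite !inE; case: eqP => // ->; apply: negPf.
  (* Two distinct players are required for [n - 1 - 1 + 1 = n - 1]. *)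
  have nN : (1 < #|N|)%N.
    by have := max_card (mem [set i; j]); rewrite cards2 ij.
  apply: eq_bigr => A _; rewrite !cards1 subnK ?subn_gt0 //.
  by rewrite -!subnDA addnC.
split=> [recI N v S T ST ST0 | IE N v S T ST]; last first.
  (* From the formula to (R): the hypothesis identifies [I] with [biindex] on every nontrivial pair,
     and [biindex] obeys both recursions. *)
  have {}IE (M : finType) (w : bigame R M) (A B : {set M}) :
      A :&: B = set0 -> (A != set0) || (B != set0) ->
      ev (I M w) A B = biindex w A B.
    move=> AB AB0; rewrite biindexE //; apply: IE => //.
    by rewrite xpair_eqE negb_and.
  split=> [S0|T0].
    rewrite IE ?S0 // biindex_recl // IE ?None_to_reduced_disjoint //; last first.
      by rewrite -cards_eq0 cards1.
    congr (_ - _); apply: eq_bigr => K /andP[_ KS].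
    rewrite IE ?to_restD_neq0 // to_rest_disjoint //.
    by rewrite setIDAC ST set0D.
  rewrite IE ?T0 ?orbT // biindex_recr // IE; last 2 first.
  - by rewrite setIC None_to_reduced_disjoint.
  - by rewrite orbC -cards_eq0 cards1.
  congr (_ - _); apply: eq_bigr => K /andP[_ KT].
  rewrite IE ?to_restD_neq0 ?orbT // to_rest_disjoint //.
  by rewrite setIDA ST set0D.
rewrite -biindexE //.
have [n] := ubnP (#|S| + #|T|).
(* The player set and the game are generalized, since the recursion passes to games on other player
   sets. *)
elim: n N v S T ST ST0 => // n IHn N v S T ST; rewrite xpair_eqE negb_and ltnS.
move=> ST0 leSTn.
have {}IHn (M : finType) (w : bigame R M) (A B : {set M}) :
    A :&: B = set0 -> (A != set0) || (B != set0) ->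
    (#|A| + #|B| < #|S| + #|T|)%N -> ev (I M w) A B = biindex w A B.
  move=> AB AB0 lt; apply: IHn => //; first by rewrite xpair_eqE negb_and.
  exact: leq_trans leSTn.
have [recS recT] := recI N v S T ST.
(* When [s >= 2], merging [S] into one player and deleting a nonempty [K] both lower [s] and leave
   [t] unchanged, so the induction hypothesis covers the whole right-hand side. *)
have [S1 | S1] := ltnP 1 #|S|.
  have S0 : S != set0 by rewrite -card_gt0 ltnW.
  rewrite recS // biindex_recl //; congr (_ - _).
    apply: IHn; rewrite ?None_to_reduced_disjoint ?cards1 //.
      by rewrite -cards_eq0 cards1.
    rewrite card_to_reduced ?ltn_add2r // subsetC //.
    by rewrite -disjoints_subset -setI_eq0 ST.
  apply: eq_bigr => K /andP[K0 KS]; have KS' := proper_sub KS.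
  apply: IHn; rewrite ?to_restD_neq0 //.
    by rewrite to_rest_disjoint // setIDAC ST set0D.
  rewrite -addSn leq_add ?card_to_restD // card_to_rest // subsetC.
  by rewrite (subset_trans KS') // -disjoints_subset -setI_eq0 ST.
(* With [s <= 1], the second recursion lowers [t] in the same way. *)
have [T1 | T1] := ltnP 1 #|T|.
  have T0 : T != set0 by rewrite -card_gt0 ltnW.
  rewrite recT // biindex_recr //; congr (_ - _).
    apply: IHn; rewrite ?cards1 //.
      by rewrite setIC None_to_reduced_disjoint.
      by rewrite orbC -cards_eq0 cards1.
    by rewrite card_to_reduced ?ltn_add2l // -disjoints_subset -setI_eq0 ST.
  apply: eq_bigr => K /andP[K0 KT]; have KT' := proper_sub KT.
  apply: IHn; rewrite ?to_restD_neq0 ?orbT //.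
    by rewrite to_rest_disjoint // setIDA ST set0D.
  rewrite -addnS leq_add ?card_to_restD // card_to_rest // subsetC.
  by rewrite (subset_trans KT') // subsetC -disjoints_subset -setI_eq0 ST.
(* Now [s] and [t] are at most 1 and not both zero, which leaves the three given initial values. *)
have [S0|] := eqVneq S set0.
  move: ST0; rewrite S0 eqxx /= => T0.
  by have /cards1P[j ->] : #|T| == 1%N by rewrite eqn_leq T1 card_gt0.
rewrite -card_gt0 => S0; have /cards1P[i eS] : #|S| == 1%N by rewrite eqn_leq S1.
have [->|] := eqVneq T set0; first by rewrite eS.
rewrite -card_gt0 => T0; have /cards1P[j eT] : #|T| == 1%N by rewrite eqn_leq T1.
rewrite eS eT base_lr //; apply/eqP=> ij.
by have /setP/(_ i) := ST; rewrite eS eT ij !inE eqxx.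
Qed.
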